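(* Let $n\ge 4$ and let $\pi\in S_n$ be a permutation of $\{1,\dots,n\}$. Then the output of the procedure $\textsc{tau-star}(\pi)$ (defined in the context) equals the Bergsma--Dassios--Yanagimoto statistic $$\tau^{\star}(\pi)\;=\;\frac{1}{\binom n4}\left(\frac23\sum_{\sigma\in\mathcal C}\#\sigma(\pi)\;-\;\frac13\sum_{\sigma\in\mathcal D}\#\sigma(\pi)\right).$$
   Context: Permutations are written in one-line notation $\pi=\pi(1)\pi(2)\cdots\pi(n)$. For $\sigma\in S_k$ and $\pi\in S_n$, $\#\sigma(\pi)$ is the number of occurrences of the pattern $\sigma$ in $\pi$, i.e. the number of $k$-tuples $x_1<\dots<x_k$ in $\{1,\dots,n\}$ such that for all $i,j$: $\pi(x_i)<\pi(x_j)$ iff $\sigma(i)<\sigma(j)$. The concordant and discordant patterns are $\mathcal C=\{1234,1243,2134,2143,3412,3421,4312,4321\}$ and $\mathcal D=S_4\setminus\mathcal C$. (The statistic $\tau^\star$ equals $12T_n$, where $T_n=\binom n4^{-1}\left(\frac1{18}\sum_{\sigma\in\mathcal C}\#\sigma-\frac1{36}\sum_{\sigma\in\mathcal D}\#\sigma\right)$.) For a numeric array $A$ indexed by $1,\dots,n$, $A.\textsc{prefix-sum}(y)$ returns $A[1]+\dots+A[y]$ and $A.\textsc{suffix-sum}(y)$ returns $A[y]+\dots+A[n]$. Procedure $\textsc{quad}(\pi)$, for $\pi\in S_n$: Set $N\leftarrow 0$ and initialize four arrays $A,A_u,A_d,A_{ud}$ of size $n$ to all zeros. For $x=1,2,\dots,n$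 in this order, perform the following steps in this order: 1. $N_u\leftarrow A.\textsc{prefix-sum}(\pi(x))$; 2. $N_d\leftarrow A.\textsc{suffix-sum}(\pi(x))$; 3. $N_{du}\leftarrow A_d.\textsc{prefix-sum}(\pi(x))$; 4. $N_{ud}\leftarrow A_u.\textsc{suffix-sum}(\pi(x))$; 5. $N_{udu}\leftarrow A_{ud}.\textsc{prefix-sum}(\pi(x))$; 6. $A[\pi(x)]\leftarrow 1$; 7. $A_u[\pi(x)]\leftarrow N_u$; 8. $A_d[\pi(x)]\leftarrow N_d$; 9. $A_{ud}[\pi(x)]\leftarrow N_{ud}$; 10. $\Delta\leftarrow 2N_{udu}-N_{du}N_d-N_{ud}N_u+(x-2)N_uN_d$; 11. $N\leftarrow N+\Delta$. Return $N$. Procedure $\textsc{tau-star}(\pi)$, for $\pi\in S_n$: let $S$ be the sum of the four values $\textsc{quad}(\pi(1),\dots,\pi(n))$, $\textsc{quad}(\pi(n),\dots,\pi(1))$, $\textsc{quad}(\pi^{-1}(1),\dots,\pi^{-1}(n))$, $\textsc{quad}(\pi^{-1}(n),\dots,\pi^{-1}(1))$, where each argument is a permutation in one-line notation. Return $\frac23-\frac14\,S/\binom n4$. *)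

(* Defs.v *)
From mathcomp Require Import all_boot all_order all_algebra all_fingroup.

Set Implicit Arguments.
Unset Strict Implicit.
Unset Printing Implicit Defensive.

Import GRing.Theory.
Local Open Scope ring_scope.

(* A permutation of {1, ..., n} is an element of 'S_n, positions and values
   being shifted down by one. *)

(* The 1-based one-line notation. *)
Definition one_line (n : nat) (pi : 'S_n) : seq nat :=
  [seq (pi i).+1 | i <- enum 'I_n].

Definition increasing_positions (k n : nat) (x : k.-tuple 'I_n) : bool :=
  [forall i : 'I_k, forall j : 'I_k,
     (i < j)%N ==> (tnth x i < tnth x j)%N].

Definition same_order (k n : nat) (sigma : 'S_k) (pi : 'S_n)
    (x : k.-tuple 'I_n) : bool :=
  [forall i : 'I_k, forall j : 'I_k,
     (pi (tnth x i) < pi (tnth x j))%N == (sigma i < sigma j)%N].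

Definition occ (k n : nat) (sigma : 'S_k) (pi : 'S_n) : nat :=
  #|[set x : k.-tuple 'I_n |
      increasing_positions x && same_order sigma pi x]|.

Definition concordant : {set 'S_4} :=
  [set sigma : 'S_4 | one_line sigma \in
    [:: [:: 1; 2; 3; 4]; [:: 1; 2; 4; 3]; [:: 2; 1; 3; 4]; [:: 2; 1; 4; 3];
        [:: 3; 4; 1; 2]; [:: 3; 4; 2; 1]; [:: 4; 3; 1; 2]; [:: 4; 3; 2; 1]]%N].

Definition discordant : {set 'S_4} := ~: concordant.

Definition array (n : nat) := {ffun 'I_n -> int}.

Definition zeros (n : nat) : array n := [ffun => 0].

Definition prefix_sum (n : nat) (A : array n) (y : 'I_n) : int :=
  \sum_(i < n | (i <= y)%N) A i.

Definition suffix_sum (n : nat) (A : array n) (y : 'I_n) : int :=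
  \sum_(i < n | (y <= i)%N) A i.

Definition update (n : nat) (A : array n) (y : 'I_n) (v : int) : array n :=
  [ffun i => if i == y then v else A i].

Record quad_state (n : nat) := QuadState {
  st_N : int;
  st_A : array n;
  st_Au : array n;
  st_Ad : array n;
  st_Aud : array n
}.

Definition quad_init (n : nat) : quad_state n :=
  QuadState 0 (zeros n) (zeros n) (zeros n) (zeros n).

(* As positions are 0-based here, the factor x - 2 reads x.+1 - 2. *)
Definition quad_step (n : nat) (pi : 'S_n) (s : quad_state n) (x : 'I_n) :
    quad_state n :=
  let y := pi x in
  let Nu := prefix_sum (st_A s) y in
  let Nd := suffix_sum (st_A s) y in
  let Ndu := prefix_sum (st_Ad s) y in
  let Nud := suffix_sum (st_Au s) y in
  let Nudu := prefix_sum (st_Aud s) y in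
  let Delta :=
    2 * Nudu - Ndu * Nd - Nud * Nu + ((x.+1)%:Z - 2) * Nu * Nd in
  QuadState (st_N s + Delta)
    (update (st_A s) y 1)
    (update (st_Au s) y Nu)
    (update (st_Ad s) y Nd)
    (update (st_Aud s) y Nud).

(* enum 'I_n lists the positions in increasing order. *)
Definition quad (n : nat) (pi : 'S_n) : int :=
  st_N (foldl (quad_step pi) (quad_init n) (enum 'I_n)).

Definition rev_perm (n : nat) : 'S_n := perm (@rev_ord_inj n).

(* Products in 'S_n compose from left to right, so rev_perm n * pi has
   one-line notation pi(n) ... pi(1). *)
Definition reversal (n : nat) (pi : 'S_n) : 'S_n := (rev_perm n * pi)%g.

Definition tau_star (n : nat) (pi : 'S_n) : rat :=
  let S := quad pi + quad (reversal pi)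
           + quad (pi^-1)%g + quad (reversal (pi^-1)%g) in
  2 / 3 - 1 / 4 * (S%:~R / ('C(n, 4))%:R).

(* Main.v *)
Require Import Defs.
From mathcomp Require Import all_boot all_order all_algebra all_fingroup.
From mathcomp Require Import ring zify.

(* Each step of [quad] adds, for the current position [d], a signed count of
   triples of earlier positions, so [quad pi] is a sum over quadruples of
   distinct positions of a weight depending only on the position order [P] and
   the value order [V]. Reversing the permutation flips [P] and inverting it
   exchanges [P] and [V], so the four runs add up to one such sum, for the weight
   [sym_weight]. Grouping the quadruples by their underlying sets, the total
   weight of a set depends only on the pattern it realizes, and a check of the 24
   patterns gives 4 for the discordant ones and 0 for the concordant ones. The
   identity follows since all the pattern counts sum up to ['C(n, 4)]. *)

Set Implicit Arguments.
Unset Strict Implicit.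
Unset Printing Implicit Defensive.

Import GRing.Theory Num.Theory.
Local Open Scope ring_scope.

(** * Weights of quadruples of positions *)

(* The four terms are those of Delta, restricted to distinct [a, b, c] (with
   [P a c || P c a] standing for [a != c]); [d] is the position x. *)
Definition weight (T : Type) (P V : rel T) (a b c d : T) : int :=
  2 * [&& P c d, V c d, P b c, V c b, P a b & V a b]%:R
  - [&& P a c || P c a, P b d, V b d, P a b, V b a, P c d & V d c]%:R
  - [&& P a c || P c a, P b d, V d b, P a b, V a b, P c d & V c d]%:R
  + [&& P a c || P c a, P b c || P c b, P a d, V a d, P b d, V d b & P c d]%:R.

Definition flip (T : Type) (P : rel T) : rel T := fun i j => P j i.

Definition sym_weight (T : Type) (P V : rel T) (a b c d : T) : int :=
  weight P V a b c d + weight (flip P) V a b c d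
  + weight V P a b c d + weight (flip V) P a b c d.

Lemma eq_weight (T : Type) (P P' V V' : rel T) (a b c d : T) :
  P =2 P' -> V =2 V' -> weight P V a b c d = weight P' V' a b c d.
Proof. by move=> eqP eqV; rewrite /weight !eqP !eqV. Qed.

Lemma eq_sym_weight (T : Type) (P P' V V' : rel T) (a b c d : T) :
  P =2 P' -> V =2 V' -> sym_weight P V a b c d = sym_weight P' V' a b c d.
Proof. by move=> eqP eqV; rewrite /sym_weight /weight /flip !eqP !eqV. Qed.

(** Each of the four conjunctions forces [a], [b], [c], [d] to be pairwise distinct, either directly
    or through a comparison obtained by transitivity of [P] or [V]. *)
Lemma weight_not_uniq (T : eqType) (P V : rel T) (a b c d : T) :
    irreflexive P -> transitive P -> irreflexive V -> transitive V ->
  ~~ uniq [:: a; b; c; d] -> weight P V a b c d = 0.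
Proof.
move=> Pirr Ptr Virr Vtr not_uniq.
have Pneq x y : P x y -> x != y by apply: contraTneq => ->; rewrite Pirr.
have Vneq x y : V x y -> x != y by apply: contraTneq => ->; rewrite Virr.
have PPneq x y : P x y || P y x -> x != y.
  by case/orP => /Pneq //; rewrite eq_sym.
have zero (e : bool) :
    (e -> [/\ [/\ a != b, a != c & a != d], b != c, b != d & c != d]) ->
    e%:R = 0 :> int.
  case: e => // /(_ isT) [[ab ac ad] bc bd cd]; case/negP: not_uniq.
  by rewrite /= !inE !negb_or ab ac ad bc bd cd.
rewrite /weight !zero //.
- case/and5P => ac bc Pad Vad /and3P[Pbd Vdb Pcd].
  by have Vab := Vtr _ _ _ Vad Vdb; split; [split | | |]; auto.
- case/and5P => ac Pbd Vdb Pab /and3P[Vab Pcd Vcd].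
  have Pad := Ptr _ _ _ Pab Pbd; have Vcb := Vtr _ _ _ Vcd Vdb.
  by split; [split | rewrite eq_sym | |]; auto.
- case/and5P => ac Pbd Vbd Pab /and3P[Vba Pcd Vdc].
  have Pad := Ptr _ _ _ Pab Pbd; have Vbc := Vtr _ _ _ Vbd Vdc.
  by split; [split | | |]; auto.
- case/and5P => Pcd Vcd Pbc Vcb /andP[Pab Vab].
  have Pac := Ptr _ _ _ Pab Pbc; have Pbd := Ptr _ _ _ Pbc Pcd.
  have Pad := Ptr _ _ _ Pac Pcd.
  by split; [split | | |]; auto.
Qed.

Lemma sym_weight_not_uniq (T : eqType) (P V : rel T) (a b c d : T) :
    irreflexive P -> transitive P -> irreflexive V -> transitive V ->
  ~~ uniq [:: a; b; c; d] -> sym_weight P V a b c d = 0.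
Proof.
move=> Pirr Ptr Virr Vtr not_uniq.
have flip_tr (Q : rel T) : transitive Q -> transitive (flip Q).
  by move=> Qtr y x z Qyx Qzy; apply: Qtr Qyx.
by rewrite /sym_weight !weight_not_uniq //; apply: flip_tr.
Qed.

(** * Sums over 4-tuples *)

Notation idx4 i := (@Ordinal 4 i isT).

Definition apply4 (T R : Type) (F : T -> T -> T -> T -> R) (t : 4.-tuple T) : R :=
  F (tnth t (idx4 0)) (tnth t (idx4 1)) (tnth t (idx4 2)) (tnth t (idx4 3)).

(** The sum over [d] stands outermost because [d] is the position of the current step, whose
    increment is a sum over [a], [b], [c]. *)
Lemma big_tuple4 (I : finType) (F : I -> I -> I -> I -> int) :
  \sum_d \sum_a \sum_b \sum_c F a b c d = \sum_(t : 4.-tuple I) apply4 F t.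
Proof.
rewrite !pair_bigA /=.
rewrite (reindex (fun t : 4.-tuple I =>
  (tnth t (idx4 3), tnth t (idx4 0), tnth t (idx4 1), tnth t (idx4 2)))) //=.
exists (fun p => [tuple p.1.1.2; p.1.2; p.2; p.1.1.1]) => [t _|[[[d a] b] c] _] //.
apply: eq_from_tnth => i; rewrite (tnth_nth (tnth t i)) /=.
case: i => -[|[|[|[|//]]]] lt_i /=; congr (tnth t _); exact: val_inj.
Qed.

Lemma apply4_map (T U R : Type) (h : T -> U) (F : U -> U -> U -> U -> R) t :
  apply4 F (map_tuple h t) = apply4 (fun a b c d => F (h a) (h b) (h c) (h d)) t.
Proof. by rewrite /apply4 !tnth_map. Qed.

Lemma apply4_uniq (T : eqType) (t : 4.-tuple T) :
  apply4 (fun a b c d => uniq [:: a; b; c; d]) t = uniq t.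
Proof.
case/tupleP: t => a t; case/tupleP: t => b t.
case/tupleP: t => c t; case/tupleP: t => d t.
by rewrite (tuple0 t) /apply4 !(tnth_nth a).
Qed.

(** * One run of [quad] as a sum of weights *)

Definition ord_lt (n : nat) : rel 'I_n := fun i j => (i < j)%N.

Section Quad.
Variable n : nat.
Implicit Types (pi : 'S_n) (f g : 'I_n -> int).

(** An array after [m] steps: cells are indexed by values, hence [pi^-1], and [f a] is what step [a]
    stores. *)
Definition row_of pi (m : nat) f : array n :=
  [ffun y => if ((pi^-1)%g y < m)%N then f ((pi^-1)%g y) else 0].

Lemma row_of0 pi f : row_of pi 0 f = zeros n.
Proof. by apply/ffunP=> y; rewrite !ffunE. Qed.

Lemma update_row_of pi (x : 'I_n) f :
  update (row_of pi x f) (pi x) (f x) = row_of pi x.+1 f.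
Proof.
apply/ffunP=> y; rewrite -(permKV pi y); move: (_ y) => a.
rewrite !ffunE permK (inj_eq perm_inj) ltnS [(a <= x)%N]leq_eqVlt val_eqE.
by case: eqP => [->|].
Qed.

Definition earlier_below pi f (x : 'I_n) : int :=
  \sum_(a < n) ((a < x)%N && (pi a < pi x)%N)%:R * f a.
Definition earlier_above pi f (x : 'I_n) : int :=
  \sum_(a < n) ((a < x)%N && (pi x < pi a)%N)%:R * f a.

(** The large and strict comparisons of values differ only at [a = x], whose cell still holds 0 when
    the sum is taken. *)
Lemma prefix_sum_row_of pi (x : 'I_n) f :
  prefix_sum (row_of pi x f) (pi x) = earlier_below pi f x.
Proof.
rewrite /prefix_sum (reindex_inj (@perm_inj _ pi)) /= big_mkcond.
apply: eq_bigr => a _; rewrite ffunE permK.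
have [-> | nax] := eqVneq a x; first by rewrite ltnn leqnn mul0r.
rewrite leq_eqVlt val_eqE (inj_eq perm_inj) (negPf nax) /=.
by do 2!case: (_ < _)%N; rewrite ?mul1r ?mul0r.
Qed.

Lemma suffix_sum_row_of pi (x : 'I_n) f :
  suffix_sum (row_of pi x f) (pi x) = earlier_above pi f x.
Proof.
rewrite /suffix_sum (reindex_inj (@perm_inj _ pi)) /= big_mkcond.
apply: eq_bigr => a _; rewrite ffunE permK.
have [-> | nax] := eqVneq a x; first by rewrite ltnn leqnn mul0r.
rewrite leq_eqVlt val_eqE (inj_eq perm_inj) eq_sym (negPf nax) /=.
by do 2!case: (_ < _)%N; rewrite ?mul1r ?mul0r.
Qed.

Definition quad_delta pi (x : 'I_n) : int :=
  let one := fun=> 1 in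
  let Nu := earlier_below pi one in
  let Nd := earlier_above pi one in
  let Nud := earlier_above pi Nu in
  2 * earlier_below pi Nud x - earlier_below pi Nd x * Nd x - Nud x * Nu x
  + (x.+1%:Z - 2) * Nu x * Nd x.

(** The loop invariant: a closed form of the state after [m] steps. *)
Definition quad_run pi (m : nat) : quad_state n :=
  let one := fun=> 1 in
  let Nu := earlier_below pi one in
  QuadState (\sum_(i < n | (i < m)%N) quad_delta pi i)
    (row_of pi m one) (row_of pi m Nu) (row_of pi m (earlier_above pi one))
    (row_of pi m (earlier_above pi Nu)).

Lemma quad_step_run pi (x : 'I_n) :
  quad_step pi (quad_run pi x) x = quad_run pi x.+1.
Proof.
rewrite /quad_step /quad_run /= !prefix_sum_row_of !suffix_sum_row_of.
congr QuadState; try exact: update_row_of.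
rewrite [RHS](bigD1 x) //= addrC; congr (_ + _).
by apply: eq_bigl => i; rewrite ltnS ltn_neqAle andbC.
Qed.

Lemma quad_sum_delta pi : quad pi = \sum_x quad_delta pi x.
Proof.
suff run m : (m <= n)%N ->
    foldl (quad_step pi) (quad_init n) (take m (enum 'I_n)) = quad_run pi m.
  rewrite /quad -{1}[enum _]take_size size_enum_ord run //=.
  by apply: eq_bigl => i; rewrite ltn_ord.
elim: m => [_|m IHm lt_mn].
  by rewrite take0 /= /quad_run !row_of0 big1.
rewrite (take_nth (Ordinal lt_mn)) ?size_enum_ord // foldl_rcons IHm 1?ltnW //.
have -> : nth (Ordinal lt_mn) (enum 'I_n) m = Ordinal lt_mn.
  by apply: val_inj; rewrite /= nth_enum_ord.
exact: (quad_step_run pi (Ordinal lt_mn)).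
Qed.

Lemma sum_earlier (x : 'I_n) : \sum_(c < n) (c < x)%N%:R = (x : nat)%:Z.
Proof.
rewrite -natr_sum natz; congr Posz.
rewrite -[RHS]card_ord -sum1_card (big_ord_widen n (fun=> 1%N)) 1?ltnW //.
by rewrite [RHS]big_mkcond; apply: eq_bigr => i _; case: ifP.
Qed.

Lemma triple_sum_mul (f h : 'I_n -> int) (g : 'I_n -> 'I_n -> int) :
  (\sum_b f b * \sum_a g a b) * (\sum_c h c)
  = \sum_a \sum_b \sum_c f b * g a b * h c.
Proof.
rewrite mulr_suml exchange_big /=; apply: eq_bigr => b _.
rewrite [f b * _]mulr_sumr mulr_suml; apply: eq_bigr => a _.
by rewrite mulr_sumr.
Qed.

Lemma sum_pred1 (f : 'I_n -> int) a : \sum_c (c == a)%:R * f c = f a.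
Proof.
rewrite (bigD1 a) //= eqxx mul1r big1 ?addr0 // => c /negPf->.
by rewrite mul0r.
Qed.

(* The triples with a repeated entry that the products contribute, namely
   [c = a] in [Ndu * Nd] and in [Nud * Nu], and [c = a] and [c = b] in
   [(x - 1) * Nu * Nd], compensate each other against the remaining
   [- Nu * Nd]. *)
Lemma quad_delta_sum_weight pi (d : 'I_n) :
  quad_delta pi d =
  \sum_a \sum_b \sum_c weight (@ord_lt n)
                              (relpre pi (@ord_lt n)) a b c d.
Proof.
pose P (i j : 'I_n) := (i < j)%N; pose V i j := (pi i < pi j)%N.
pose p i j : int := (P i j)%:R; pose v i j : int := (V i j)%:R.
(* [m2], [m3], [m4] are the summands of the last three terms of Delta before repeated entries are
   discarded; [w a b] is the common value of [m4 a b a] and [m4 a b b]. *)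
pose m2 a b c := p b d * v b d * (p a b * v b a) * (p c d * v d c).
pose m3 a b c := p b d * v d b * (p a b * v a b) * (p c d * v c d).
pose m4 a b c := p b d * v d b * (p a d * v a d) * p c d.
pose w a b := p b d * v d b * (p a d * v a d).
have below f x : earlier_below pi f x = \sum_a p a x * v a x * f a.
  by apply: eq_bigr => a _; rewrite -natrM mulnb.
have above f x : earlier_above pi f x = \sum_a p a x * v x a * f a.
  by apply: eq_bigr => a _; rewrite -natrM mulnb.
have below1 x : earlier_below pi (fun=> 1) x = \sum_a p a x * v a x.
  by rewrite below; under eq_bigr do rewrite mulr1.
have above1 x : earlier_above pi (fun=> 1) x = \sum_a p a x * v x a.
  by rewrite above; under eq_bigr do rewrite mulr1.
have E1 : earlier_below pi (earlier_above pi (earlier_below pi (fun=> 1))) d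
  = \sum_a \sum_b \sum_c p c d * v c d * (p b c * v c b) * (p a b * v a b).
  rewrite below; under [RHS]eq_bigr do rewrite exchange_big.
  rewrite [RHS]exchange_big; apply: eq_bigr => c _.
  rewrite above [RHS]exchange_big mulr_sumr; apply: eq_bigr => b _.
  by rewrite below1 !mulr_sumr; apply: eq_bigr => a _; rewrite !mulrA.
have E2 : earlier_below pi (earlier_above pi (fun=> 1)) d
    * earlier_above pi (fun=> 1) d = \sum_a \sum_b \sum_c m2 a b c.
  rewrite above1 below; under eq_bigr do rewrite above1.
  by rewrite triple_sum_mul.
have E3 : earlier_above pi (earlier_below pi (fun=> 1)) d
    * earlier_below pi (fun=> 1) d = \sum_a \sum_b \sum_c m3 a b c.
  rewrite below1 above; under eq_bigr do rewrite below1.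
  by rewrite triple_sum_mul.
have E4 : (d.+1%:Z - 2) * earlier_below pi (fun=> 1) d
    * earlier_above pi (fun=> 1) d
   = \sum_a \sum_b \sum_c m4 a b c - \sum_a \sum_b w a b.
  (* The 0-based position [d] is the number of positions [c] before it; the remaining [- 1] produces
     the sum of [w]. *)
  have -> : d.+1%:Z - 2 = \sum_c p c d - 1 by rewrite sum_earlier; lia.
  rewrite -triple_sum_mul -mulr_suml -below1 -above1.
  have -> : \sum_a \sum_b w a b
      = earlier_above pi (fun=> 1) d * earlier_below pi (fun=> 1) d.
    rewrite below1 above1 mulr_suml exchange_big; apply: eq_bigr => b _.
    by rewrite mulr_sumr.
  by ring.
(* In [w a b] the value of [a] is below that of [d], itself below that of [b], so [a] and [b]
   differ. If [a] comes first the term is [m3 a b a], otherwise it is [m2 b a b], whence the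
   exchange of sums for [m2]. *)
have Ew : \sum_a \sum_b w a b
    = \sum_a \sum_b m2 a b a + \sum_a \sum_b m3 a b a.
  rewrite [X in _ = X + _]exchange_big -big_split; apply: eq_bigr => a _.
  rewrite -big_split; apply: eq_bigr => b _ /=.
  rewrite /w /m2 /m3 /p /v -!natrM -natrD; congr (_%:R).
  have [Vad|_] := boolP (V a d); last by rewrite !(muln0, mul0n).
  have [Vdb|_] := boolP (V d b); last by rewrite !(muln0, mul0n).
  have Vab : V a b by move: Vad Vdb; rewrite /V; lia.
  have neq_ab : val a != val b.
    by apply: contraTneq Vad => /val_inj->; move: Vdb; rewrite /V; lia.
  rewrite Vab /P; case: (ltngtP a b) neq_ab => // _ _; lia.
have Ewt a b c : weight P V a b c d
  = 2 * (p c d * v c d * (p b c * v c b) * (p a b * v a b))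
    - (m2 a b c - (c == a)%:R * m2 a b c) - (m3 a b c - (c == a)%:R * m3 a b c)
    + (m4 a b c - (c == a)%:R * m4 a b c - (c == b)%:R * m4 a b c).
  have neqP i j : P i j || P j i = (j != i) by rewrite -neq_ltn eq_sym.
  have natb (e1 e2 : bool) : (e1 && e2)%:R = e1%:R * e2%:R :> int.
    by rewrite -natrM mulnb.
  have Vasym i : v i d * v d i = 0.
    by rewrite /v -natrM mulnb; case: (boolP (_ && _)); rewrite // /V; lia.
  have -> : weight P V a b c d =
      2 * (p c d * (v c d * (p b c * (v c b * (p a b * v a b)))))
      - (c != a)%:R * (p b d * (v b d * (p a b * (v b a * (p c d * v d c)))))
      - (c != a)%:R * (p b d * (v d b * (p a b * (v a b * (p c d * v c d)))))
      + (c != a)%:R * ((c != b)%:R * (p a d * (v a d * (p b d * (v d b * p c d))))).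
    by rewrite /weight !neqP !natb.
  rewrite /m2 /m3 /m4.
  have [->|_] := eqVneq c a; last have [->|_] := eqVneq c b.
  (* For [c = a = b] the term [m4] is removed twice, which is harmless: it contains [v b d * v d b],
     which is 0. *)
  - have [->|_] := eqVneq a b; rewrite /=.
      ring: (Vasym b).
    by ring.
  - by rewrite /=; ring.
  by rewrite /=; ring.
rewrite /quad_delta E1 E2 E3 E4 Ew.
have -> : \sum_a \sum_b \sum_c weight P V a b c d
   = \sum_a \sum_b (2 * (\sum_c p c d * v c d * (p b c * v c b) * (p a b * v a b))
       - (\sum_c m2 a b c - m2 a b a) - (\sum_c m3 a b c - m3 a b a)
       + (\sum_c m4 a b c - w a b - w a b)).
  apply: eq_bigr => a _; apply: eq_bigr => b _.
  under eq_bigr do rewrite Ewt.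
  rewrite big_split /= !sumrB -mulr_sumr !sum_pred1.
  have pp i j : p i j * p i j = p i j by rewrite /p -natrM mulnb andbb.
  have -> : m4 a b a = w a b by rewrite /m4 /w; ring: (pp a d).
  have -> : m4 a b b = w a b by rewrite /m4 /w; ring: (pp b d).
  by [].
under [RHS]eq_bigr do rewrite big_split /= !sumrB -mulr_sumr.
rewrite big_split /= !sumrB -mulr_sumr Ew.
by ring.
Qed.
End Quad.

(** * Increasing tuples, sorting and patterns *)

Lemma increasing_positionsE k n (x : k.-tuple 'I_n) :
  increasing_positions x = sorted ltn (map val x).
Proof.
rewrite (sorted_pairwise ltn_trans).
apply/'forall_'forall_implyP/(pairwiseP 0%N) => x_inc i j.
  rewrite !inE size_map size_tuple => lt_ik lt_jk lt_ij.
  have := x_inc (Ordinal lt_ik) (Ordinal lt_jk) lt_ij.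
  have x0 := tnth x (Ordinal lt_ik).
  by rewrite !(tnth_nth x0) !(nth_map x0) ?size_tuple.
move=> lt_ij; have x0 := tnth x i; have := x_inc i j.
rewrite !inE size_map size_tuple !ltn_ord => /(_ isT isT lt_ij).
by rewrite !(tnth_nth x0) !(nth_map x0) ?size_tuple.
Qed.

Lemma card_increasing_positions k n :
  #|[set x : k.-tuple 'I_n | increasing_positions x]| = 'C(n, k).
Proof.
rewrite -card_ltn_sorted_tuples.
by apply: eq_card => x; rewrite !inE increasing_positionsE.
Qed.

Lemma uniq_tnth_inj (T : eqType) k (x : k.-tuple T) :
  uniq x -> injective (tnth x).
Proof. by move/tuple_uniqP. Qed.

Lemma increasing_uniq k n (x : k.-tuple 'I_n) : increasing_positions x -> uniq x.
Proof.
rewrite increasing_positionsE ltn_sorted_uniq_leq => /andP[+ _].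
by rewrite (map_inj_uniq val_inj).
Qed.

Lemma increasing_ltn k n (x : k.-tuple 'I_n) (i j : 'I_k) :
  increasing_positions x -> (tnth x i < tnth x j)%N = (i < j)%N.
Proof.
move=> /'forall_'forall_implyP x_inc.
case: (ltngtP i j) => [/x_inc->|/x_inc /ltnW|/val_inj->] //; last by rewrite ltnn.
by rewrite ltnNge => ->.
Qed.

Definition sort_positions k n (t : k.-tuple 'I_n) : k.-tuple 'I_n :=
  sort_tuple (fun i j : 'I_n => i <= j)%N t.

Lemma sort_positions_increasing k n (t : k.-tuple 'I_n) :
  uniq t -> increasing_positions (sort_positions t).
Proof.
move=> t_uniq; rewrite increasing_positionsE ltn_sorted_uniq_leq.
rewrite (map_inj_uniq val_inj) sort_uniq t_uniq /= sorted_map.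
by apply: sort_sorted => i j; apply: leq_total.
Qed.

Lemma sort_positionsP k n (t x : k.-tuple 'I_n) :
  increasing_positions x -> perm_eq t x -> sort_positions t = x.
Proof.
move=> x_inc t_x; apply: val_inj => /=.
rewrite -[RHS](@sorted_sort _ (fun i j : 'I_n => i <= j)%N); first last.
- by move: x_inc; rewrite increasing_positionsE ltn_sorted_uniq_leq sorted_map => /andP[].
- by move=> ? ? ?; apply: leq_trans.
apply/perm_sortP => // [i j|? ? ?|i j]; [exact: leq_total|exact: leq_trans|].
by rewrite -eqn_leq => /eqP/val_inj.
Qed.

(** A tuple with distinct entries factors uniquely through its sorted rearrangement [x], the tuple
    [p] giving the ranks of its entries. This is the grouping of quadruples by underlying sets. *)
Lemma big_uniq_tuple (k n : nat) (F : k.+1.-tuple 'I_n -> int) :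
  \sum_(t : k.+1.-tuple 'I_n | uniq t) F t =
  \sum_(x : k.+1.-tuple 'I_n | increasing_positions x)
    \sum_(p : k.+1.-tuple 'I_k.+1 | uniq p) F (map_tuple (tnth x) p).
Proof.
rewrite (partition_big (@sort_positions _ _) (@increasing_positions _ _)); last first.
  exact: sort_positions_increasing.
apply: eq_bigr => x x_inc; have x_uniq := increasing_uniq x_inc.
(* The default of [inord] is never reached on the entries of [x], whose index is at most [k]; this
   is [indexK]. *)
pose rank (t : k.+1.-tuple 'I_n) := map_tuple (fun i => inord (index i x) : 'I_k.+1) t.
have indexK i : i \in x -> tnth x (inord (index i x)) = i.
  move=> xi; rewrite (tnth_nth i) inordK ?nth_index //.
  by rewrite -[X in (_ < X)%N](size_tuple x) index_mem.
rewrite (reindex_onto (map_tuple (tnth x)) rank) => [|t /andP[_ /eqP sort_t]].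
  apply: eq_bigl => p; apply/idP/idP.
    by move=> /andP[/andP[+ _] _]; apply: map_uniq.
  move=> p_uniq; rewrite (map_inj_uniq (uniq_tnth_inj x_uniq)) p_uniq /=.
  apply/andP; split; apply/eqP.
    apply: sort_positionsP => //=.
    rewrite -[X in perm_eq _ X]map_tnth_enum perm_map //.
    apply: uniq_perm => //; first exact: enum_uniq.
    (* Having [k.+1] distinct entries, [p] exhausts ['I_k.+1], so composing it with [x] permutes the
       entries of [x]. *)
    have [//| |_ eq_p i] := uniq_min_size p_uniq (s2 := enum 'I_k.+1).
      by move=> i; rewrite mem_enum.
      by rewrite size_enum_ord size_tuple.
    by rewrite eq_p.
  apply: eq_from_tnth => i; rewrite !tnth_map.
  apply: (uniq_tnth_inj x_uniq); rewrite indexK ?mem_tnth //.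
apply: eq_from_tnth => i; rewrite !tnth_map indexK //.
by rewrite -sort_t mem_sort mem_tnth.
Qed.

(** The pattern sends [i] to the number of entries whose value is below that of entry [i]. The
    equivalence also records uniqueness, so that a sum over the patterns of [x] has a single
    term. *)
Lemma exists_same_order k n (pi : 'S_n) (x : k.-tuple 'I_n) :
  uniq x -> exists sigma, forall tau, same_order tau pi x = (tau == sigma).
Proof.
move=> x_uniq; pose y i := pi (tnth x i).
have y_inj : injective y.
  by apply: inj_comp; [exact: perm_inj | exact: uniq_tnth_inj].
have lt_rank i : (#|[set j | y j < y i]%N| < k)%N.
  rewrite -[X in (_ < X)%N]card_ord -cardsT; apply: proper_card.
  rewrite properT; apply/negP => /eqP /setP /(_ i).
  by rewrite !inE ltnn.
pose rank i := Ordinal (lt_rank i).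
have rank_mono i j : (rank i < rank j)%N = (y i < y j)%N.
  have rank_le a b : (y a <= y b)%N -> (rank a <= rank b)%N.
    move=> le_ab; apply/subset_leq_card/subsetP => l; rewrite !inE.
    by move/leq_trans; apply.
  apply/idP/idP => [|lt_ij]; first by rewrite !ltnNge; apply/contraNN/rank_le.
  apply/proper_card/properP; split.
    by apply/subsetP => l; rewrite !inE => /ltn_trans; apply.
  by exists i; rewrite !inE ?ltnn.
have rank_inj : injective rank.
  move=> i j eq_ij; apply: y_inj; apply: val_inj; apply/eqP.
  have le_y a b : rank a = rank b -> (y a <= y b)%N.
    by move=> eq_ab; rewrite leqNgt -rank_mono eq_ab ltnn.
  by rewrite eqn_leq !le_y.
exists (perm rank_inj) => tau; apply/idP/eqP => [|->].
  move=> /'forall_'forall_eqP tau_y; apply/permP => i; rewrite permE.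
  apply: val_inj => /=.
  (* Uniqueness: [tau i] is the number of values below it, and [tau] carries the entries below entry
     [i] bijectively onto these values. *)
  have -> : [set j | y j < y i]%N = tau @^-1: [set l : 'I_k | l < tau i]%N.
    by apply/setP => j; rewrite !inE /y tau_y.
  rewrite card_preimset; last exact: perm_inj.
  rewrite -sum1dep_card -(big_ord_widen k (fun=> 1%N)) 1?ltnW //.
  by rewrite sum1_card card_ord.
by apply/'forall_'forall_eqP => i j; rewrite !permE rank_mono.
Qed.

(** * The four runs as a single sum *)

Lemma quad_sum_weight n (pi : 'S_n) :
  quad pi = \sum_(t : 4.-tuple 'I_n)
              apply4 (weight (@ord_lt n) (relpre pi (@ord_lt n))) t.
Proof.
rewrite quad_sum_delta -big_tuple4.
by apply: eq_bigr => d _; rewrite quad_delta_sum_weight.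
Qed.

(** Renaming positions by [h] lets runs on different permutations be compared on the same
    quadruple. *)
Lemma quad_sum_weight_reindex n (pi h : 'S_n) :
  quad pi = \sum_(t : 4.-tuple 'I_n)
    apply4 (weight (relpre h (@ord_lt n)) (relpre (h * pi)%g (@ord_lt n))) t.
Proof.
rewrite quad_sum_weight (reindex_inj (h := map_tuple h)) => [|t u].
  apply: eq_bigr => t _; rewrite apply4_map /apply4.
  rewrite (@eq_weight _ (relpre h _) (relpre h (@ord_lt n)) (relpre (h * pi)%g _)
    (relpre h (relpre pi (@ord_lt n)))) // => i j.
  by rewrite /= !permM.
by move/(congr1 val)/(inj_map perm_inj)/val_inj.
Qed.

Lemma sum_quad_sym_weight n (pi : 'S_n) :
  quad pi + quad (reversal pi) + quad (pi^-1)%g + quad (reversal (pi^-1)%g)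
  = \sum_(t : 4.-tuple 'I_n)
      apply4 (sym_weight (@ord_lt n) (relpre pi (@ord_lt n))) t.
Proof.
have revK : (rev_perm n * rev_perm n = 1)%g.
  by apply/permP => i; rewrite permM !permE rev_ordK.
have rev_lt (i j : 'I_n) : (rev_perm n i < rev_perm n j)%N = (j < i)%N.
  by rewrite !permE /= ltn_sub2lE ?ltnS.
(* Each [h] is chosen so that [h] times the argument of [quad] is [pi] or the identity. The order
   pulled back along [h] is then the reversed position order, the value order or the reversed value
   order, respectively. *)
rewrite (quad_sum_weight pi) (quad_sum_weight_reindex (reversal pi) (rev_perm n)).
rewrite (quad_sum_weight_reindex (pi^-1)%g pi).
rewrite (quad_sum_weight_reindex (reversal (pi^-1)%g) (pi * rev_perm n)%g).
rewrite -!big_split; apply: eq_bigr => t _ /=.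
rewrite /apply4 /sym_weight; congr (_ + _ + _ + _); apply: eq_weight => i j /=;
  rewrite /flip /ord_lt ?/reversal ?mulgA ?revK ?mulgV ?mul1g ?rev_lt //.
all: try by rewrite !perm1.
all: try by rewrite !permM rev_lt.
by rewrite -(mulgA pi) revK mulg1 mulgV !perm1.
Qed.

(** * The check of the 24 patterns *)

Definition listed_concordant : seq (seq nat) :=
  [:: [:: 1; 2; 3; 4]; [:: 1; 2; 4; 3]; [:: 2; 1; 3; 4]; [:: 2; 1; 4; 3];
      [:: 3; 4; 1; 2]; [:: 3; 4; 2; 1]; [:: 4; 3; 1; 2]; [:: 4; 3; 2; 1]]%N.

(** An explicit fold over natural numbers, so that the check runs by computation. *)
Definition sum_iota4 (F : nat -> int) : int :=
  foldr (fun i s => F i + s) 0 (iota 0 4).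

Definition sum_sym_weight4 (s : seq nat) : int :=
  sum_iota4 (fun d => sum_iota4 (fun a => sum_iota4 (fun b => sum_iota4 (fun c =>
    sym_weight ltn (relpre (nth 0%N s) ltn) a b c d)))).

(** Words are 0-based here, whereas the list of concordant patterns is 1-based, hence the
    successors. *)
Lemma sum_sym_weight4E :
  all (fun a => all (fun b => all (fun c => all (fun d =>
    uniq [:: a; b; c; d] ==>
      (sum_sym_weight4 [:: a; b; c; d]
       == 4 * ([:: a.+1; b.+1; c.+1; d.+1] \notin listed_concordant)%:R))
    (iota 0 4)) (iota 0 4)) (iota 0 4)) (iota 0 4).
Proof. by vm_compute. Qed.

Lemma big_ord4 (F : nat -> int) : \sum_(i < 4) F i = sum_iota4 F.
Proof. by rewrite -(big_mkord xpredT F) unlock. Qed.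

Lemma sum_sym_weight_perm4 (sigma : 'S_4) :
  \sum_(p : 4.-tuple 'I_4 | uniq p)
    apply4 (sym_weight (@ord_lt 4) (relpre sigma (@ord_lt 4))) p
  = 4 * (sigma \in discordant)%:R.
Proof.
set F := sym_weight _ _.
(* Tuples with a repeated entry weigh 0; including them turns the sum into four independent sums
   over ['I_4]. *)
transitivity (\sum_(p : 4.-tuple 'I_4) apply4 F p).
  rewrite [RHS](bigID (fun p : 4.-tuple 'I_4 => uniq p)) /=.
  rewrite [X in _ = _ + X]big1 ?addr0 // => p.
  rewrite -apply4_uniq; apply: sym_weight_not_uniq => [i|j i k|i|j i k];
    by [exact: ltnn | exact: ltn_trans].
pose s := [seq val (sigma i) | i <- [:: idx4 0; idx4 1; idx4 2; idx4 3]].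
have enum4 : enum 'I_4 = [:: idx4 0; idx4 1; idx4 2; idx4 3].
  by apply: (inj_map val_inj); rewrite val_enum_ord.
have sE (i : 'I_4) : nth 0%N s i = sigma i.
  case: i => -[|[|[|[|//]]]] lt_i /=; congr (val (sigma _)); exact: val_inj.
have -> : \sum_(p : 4.-tuple 'I_4) apply4 F p = sum_sym_weight4 s.
  rewrite -big_tuple4 /sum_sym_weight4 -big_ord4; apply: eq_bigr => d _.
  rewrite -big_ord4; apply: eq_bigr => a _.
  rewrite -big_ord4; apply: eq_bigr => b _.
  rewrite -big_ord4; apply: eq_bigr => c _.
  have lift := @eq_sym_weight 'I_4 (@ord_lt 4) (relpre val ltn)
    (relpre sigma (@ord_lt 4)) (relpre val (relpre (nth 0%N s) ltn)).
  by rewrite /F lift // => i j; rewrite /= !sE.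
have s_uniq : uniq s.
  rewrite (map_inj_uniq (f := fun i => val (sigma i))) // => i j.
  by move/val_inj/perm_inj.
have s_lt i : val (sigma i) \in iota 0 4 by rewrite mem_iota ltn_ord.
move/allP: sum_sym_weight4E => /(_ _ (s_lt (idx4 0))) /allP /(_ _ (s_lt (idx4 1))).
move=> /allP /(_ _ (s_lt (idx4 2))) /allP /(_ _ (s_lt (idx4 3))).
move/implyP/(_ s_uniq)/eqP => ->.
by rewrite !inE /one_line enum4.
Qed.

(** * Pattern counts and the conclusion *)

(** Double counting of pairs made of a pattern and an occurrence. It serves for the weight of
    discordant patterns and for the constant 1. *)
Lemma sum_occ (R : pzRingType) k n (pi : 'S_n) (f : 'S_k -> R) :
  \sum_sigma f sigma * (occ sigma pi)%:R
  = \sum_(x : k.-tuple 'I_n | increasing_positions x)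
      \sum_(sigma | same_order sigma pi x) f sigma.
Proof.
under [RHS]eq_bigr do rewrite big_mkcond.
rewrite exchange_big; apply: eq_bigr => sigma _ /=.
rewrite /occ -sum1dep_card natr_sum mulr_sumr -big_mkcondr /=.
by apply: eq_bigr => x _; rewrite mulr1.
Qed.

Lemma sum_occ_discordant n (pi : 'S_n) :
  quad pi + quad (reversal pi) + quad (pi^-1)%g + quad (reversal (pi^-1)%g)
  = 4 * \sum_(sigma in discordant) (occ sigma pi)%:R.
Proof.
rewrite sum_quad_sym_weight; set F := sym_weight _ _.
rewrite (bigID (fun t : 4.-tuple 'I_n => uniq t)) /=.
rewrite [X in _ + X]big1 ?addr0; last first.
  move=> t; rewrite -apply4_uniq.
  apply: sym_weight_not_uniq => [i|j i k|i|j i k];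
    by [exact: ltnn | exact: ltn_trans].
have -> : 4 * (\sum_(sigma in discordant) (occ sigma pi)%:R)
    = \sum_sigma 4 * (sigma \in discordant)%:R * (occ sigma pi)%:R :> int.
  rewrite big_mkcond mulr_sumr; apply: eq_bigr => sigma _.
  by rewrite -mulrA; case: ifP; rewrite (mul1r, mul0r).
rewrite big_uniq_tuple sum_occ; apply: eq_bigr => x x_inc.
have [sigma sigmaP] := exists_same_order pi (increasing_uniq x_inc).
rewrite (big_pred1 sigma) // -sum_sym_weight_perm4; apply: eq_bigr => p _.
rewrite apply4_map /apply4 /F.
(* An increasing [x] preserves the position order, and [sigma] is the value order along [x], so the
   weight can be computed on the indices in ['I_4]. *)
have pat := @eq_sym_weight 'I_4 (@ord_lt 4) (relpre (tnth x) (@ord_lt n))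
  (relpre sigma (@ord_lt 4)) (relpre (tnth x) (relpre pi (@ord_lt n))).
rewrite pat // => i j; first by rewrite /= /ord_lt increasing_ltn.
have := sigmaP sigma; rewrite eqxx => /'forall_'forall_eqP/(_ i j).
by [].
Qed.

Lemma sum_occ_all (R : pzRingType) k n (pi : 'S_n) :
  \sum_(sigma : 'S_k) (occ sigma pi)%:R = ('C(n, k))%:R :> R.
Proof.
under eq_bigr do rewrite -[_%:R]mul1r.
rewrite (sum_occ pi (fun=> 1)) -card_increasing_positions -sum1dep_card natr_sum.
apply: eq_bigr => x x_inc.
have [sigma sigmaP] := exists_same_order pi (increasing_uniq x_inc).
by rewrite (big_pred1 sigma).
Qed.

Theorem theorem6p1 (n : nat) (hn : (4 <= n)%N) (pi : 'S_n) :
  tau_star pi =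
    1 / ('C(n, 4))%:R *
      (2 / 3 * (\sum_(sigma in concordant) (occ sigma pi)%:R)
       - 1 / 3 * (\sum_(sigma in discordant) (occ sigma pi)%:R)) :> rat.
Proof.
have bin_neq0 : ('C(n, 4))%:R != 0 :> rat by rewrite pnatr_eq0 -lt0n bin_gt0.
have := sum_occ_all rat 4 pi; rewrite (bigID [in concordant]) /=.
rewrite [X in _ + X](eq_bigl [in discordant]) => [binE|sigma]; last first.
  by rewrite /= -in_setC.
rewrite /tau_star sum_occ_discordant rmorphM rmorph_sum /=.
under [X in 1 / 4 * (4%:~R * X / _)]eq_bigr do rewrite rmorph_nat.
(* With [C] and [D] the concordant and discordant totals, the binomial is [C + D], and
   [2/3 - D/(C + D)] equals [(2/3 * C - 1/3 * D)/(C + D)]. *)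
move: bin_neq0; rewrite -binE; move: (\sum_(_ in _) _) (\sum_(_ in _) _) => C D.
by move=> CD_neq0; field.
Qed.
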